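(* Let $\mathbf{A}\in\mathbb{R}^{n\times n}$ be symmetric, let $P$ processors be arranged in a $\sqrt{P/c}\times\sqrt{P/c}\times c$ grid with replication factor $1\le c\le P^{1/3}$, let $\mu$ be a batching parameter with $c\le\mu\le\sqrt{P/c}$, and let $\eta\in[2\mu/\sqrt{cP},\,1]$ be a utilization factor. Assume that $O(1)$ sweeps of 2D parallel Jacobi are applied to each subproblem. Then one sweep of 2.5D parallel Jacobi (the algorithm described in the context) has complexity $$\alpha\cdot O\!\left(X\log\!\left(\eta\mu\sqrt{cP}\right)+\frac{\sqrt{P/c}}{\mu}\log\!\left(\frac{\sqrt{P/c}}{\mu}\right)\right)+\beta\cdot O\!\left(\frac{n^2}{X}+\frac{n^2}{\sqrt{cP}}\right)+\gamma\cdot O\!\left(\frac{n^3}{X^2}+\frac{n^3}{P}\right),$$ where $X=\sqrt[4]{\dfrac{\eta^2P^3}{\mu^2c}}$.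
   Context: **Cost model.** For a parallel algorithm on $P$ distributed-memory processors, $S$ is the number of messages sent along the critical path (longest chain of serially dependent operations), $W$ the maximum number of words communicated by any processor along it, $F$ the maximum number of flops performed by any processor along it; the cost is $\alpha S+\beta W+\gamma F$, with $\alpha,\beta,\gamma$ the times per message, word and flop. ''Complexity $\alpha\cdot O(f)+\beta\cdot O(g)+\gamma\cdot O(h)$'' means $S=O(f)$, $W=O(g)$, $F=O(h)$. Communication and computation do not overlap on a processor; there is no contention. Sending $w$ words point-to-point costs $O(1)$ messages and $O(w)$ words. Collectives involving $p$ processors and $w\ge p$ words cost: scatter or gather $\alpha\log_2p+\beta w$; broadcast $2\alpha\log_2p+2\beta w$; reduce $2\alpha\log_2p+2\beta w+\gamma w$. Local $k\times k$ matrix multiplication and symmetric diagonalization cost $O(k^3)$ flops. All quantities that need to be integers (grid dimensions, block sizes, numbers of groups) are assumed to be integers. **Subroutine: 2.5D matrix multiplication.** It multiplies two $N\times N$ matrices, initially block-distributed on the top layer of a $\sqrt{p/c}\times\sqrt{p/c}\times c$ grid of $p$ processors ($1\le c\le p^{1/3}$), by replicating the inputs to all $c$ layers, letting each layer carry out a $1/c$ fraction of the steps of Cannon's algorithm, and sum-reducing to the top layer. Its known complexity (Solomonik–Demmel) is $\alpha\cdot O(\sqrt{p/c^3}+\log c)+\beta\cdot O(N^2/\sqrt{cp})+\gamma\cdot O(N^3/p)$. **Index list.** For an integer $q$, the anti-diagonal list on $q$ indices consists of $q$ groups; for $K=0,\dots,q-1$ the group consists of all pairs $(I,J)$, $1\le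 I<J\le q$, with $I+J\equiv K\pmod q$. Pairs within a group are disjoint. **Subroutine: one sweep of 2D parallel Jacobi** on a symmetric $N\times N$ matrix $\mathbf{M}$ and orthogonal $\mathbf{Q}$, both distributed in $\hat b\times\hat b$ blocks, $\hat b=N/\sqrt p$, on a $\sqrt p\times\sqrt p$ grid (one block of each per processor $(I,J)$). Groups of the anti-diagonal list on $\sqrt p$ indices are processed serially; for each group all pairs $(I,J)$ are processed in parallel: processors $(I,I)$ and $(J,J)$ send their diagonal blocks to $(I,J)$, which locally diagonalizes the $2\hat b\times2\hat b$ matrix $\mathbf{M}([I,J],[I,J])=\mathbf{V}\mathbf{D}\mathbf{V}^T$ and sends the needed $\hat b\times\hat b$ blocks of $\mathbf{V},\mathbf{D}$ to $(I,I),(J,J),(J,I)$; $\mathbf{M}([I,J],[I,J])$ is overwritten by $\mathbf{D}$; processors in block rows $I,J$ (and block columns $I,J$) pairwise exchange their blocks of $\mathbf{M}$ (and of $\mathbf{Q}$, for columns); $(I,I)$ and $(J,J)$ each broadcast two $\hat b\times\hat b$ blocks of $\mathbf{V}$ along their row and column; then each processor in block rows/columns $I,J$ updates its blocks locally, so that block rows $I,J$ of $\mathbf{M}$ are multiplied on the left by $\mathbf{V}^T$, and block columns $I,J$ of $\mathbf{M}$ and $\mathbf{Q}$ on the right by $\mathbf{V}$. **2.5D layout.** Processors are $\mathrm{Proc}\langle p,q,r\rangle$, $1\le p,q\le\sqrt{P/c}$, $1\le r\le c$; $r=1$ is the top layer. Let $b=n/\sqrt{P/c}$ and $B=\mu b$.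 On the top layer, each processor owns one $b\times b$ block (fine tile) of $\mathbf{A}$ and of the accumulated orthogonal matrix $\mathbf{Q}\in\mathbb{R}^{n\times n}$. For $1\le I,J\le n/B=\sqrt{P/c}/\mu$, the coarse tile $\mathbf{A}_{IJ}=\mathbf{A}((I-1)B+1:IB,(J-1)B+1:JB)$ (likewise $\mathbf{Q}_{IJ}$) is distributed over $\mathrm{ProcTile}(I,J,1)$, where $\mathrm{ProcTile}(I,J,k)=\{\mathrm{Proc}\langle p,q,k\rangle:(I-1)\mu+1\le p\le I\mu,\ (J-1)\mu+1\le q\le J\mu\}$. $\mathrm{ProcSlab}(\cdot,\cdot,\cdot)$ denotes the union of the tiles whose indices lie in the given lists ('':'' meaning all). Sends, exchanges and broadcasts between coarse processor tiles are performed between individual processors occupying the same position within each tile. **One sweep of 2.5D parallel Jacobi.** The groups $g$ of the anti-diagonal list on $\sqrt{P/c}/\mu$ indices are processed serially; for each $g$, all $(I,J)\in g$ are processed in parallel: 1. The $2B\times2B$ subproblem $\hat{\mathbf{A}}=\mathbf{A}([I,J],[I,J])$ is scattered from $\mathrm{ProcSlab}([I,J],[I,J],1)$ ($4\mu^2$ processors) to a set $\hat{\mathfrak{P}}$ of $2\eta\mu\sqrt{cP}$ processors of $\mathrm{ProcSlab}(:,[I,J],:)$ (an $\eta$ fraction of that slab), rearranged as a square 2D grid; each sending processor scatters its $b\times b$ block to $O(\eta\sqrt{cP}/\mu)$ processors. $\hat{\mathbf{V}}$ is initialized to the $2B\times 2B$ identity over $\hat{\mathfrak{P}}$. 2. Sweeps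 of 2D parallel Jacobi are applied to $(\hat{\mathbf{A}},\hat{\mathbf{V}})$ over $\hat{\mathfrak{P}}$ until convergence or a maximum number of sweeps. 3. $\hat{\mathbf{A}},\hat{\mathbf{V}}$ are gathered back to $\mathrm{ProcSlab}([I,J],[I,J],1)$ (reverse of step 1) and $\mathbf{A}([I,J],[I,J])$ is overwritten by $\hat{\mathbf{A}}$. Partition $\hat{\mathbf{V}}=(\hat{\mathbf{V}}_{ij})_{i,j\in\{1,2\}}$ into $B\times B$ blocks. 4. $\mathrm{ProcTile}(J,I,1)$ sends $\hat{\mathbf{V}}_{21}$ to $\mathrm{ProcTile}(I,I,1)$; $\mathrm{ProcTile}(I,J,1)$ sends $\hat{\mathbf{V}}_{12}$ to $\mathrm{ProcTile}(J,J,1)$. 5. For all $K$ in parallel on the top layer: exchange $\mathbf{A}_{IK}\leftrightarrow\mathbf{A}_{JK}$ and $\mathbf{A}_{KI}\leftrightarrow\mathbf{A}_{KJ}$ (if $K\ne I,J$) and $\mathbf{Q}_{KI}\leftrightarrow\mathbf{Q}_{KJ}$ between the owning tiles. 6. $\mathrm{ProcTile}(I,I,1)$ broadcasts $\hat{\mathbf{V}}_{11},\hat{\mathbf{V}}_{21}$ to all other top-layer tiles in coarse row $I$ and coarse column $I$; $\mathrm{ProcTile}(J,J,1)$ broadcasts $\hat{\mathbf{V}}_{12},\hat{\mathbf{V}}_{22}$ to those in coarse row $J$ and column $J$. 7. For all $K$ in parallel, the coarse tiles are updated: for $K\ne I,J$, $\mathbf{A}_{IK}\leftarrow\hat{\mathbf{V}}_{11}^T\mathbf{A}_{IK}+\hat{\mathbf{V}}_{21}^T\mathbf{A}_{JK}$,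 $\mathbf{A}_{JK}\leftarrow\hat{\mathbf{V}}_{12}^T\mathbf{A}_{IK}+\hat{\mathbf{V}}_{22}^T\mathbf{A}_{JK}$, $\mathbf{A}_{KI}\leftarrow\mathbf{A}_{KI}\hat{\mathbf{V}}_{11}+\mathbf{A}_{KJ}\hat{\mathbf{V}}_{21}$, $\mathbf{A}_{KJ}\leftarrow\mathbf{A}_{KI}\hat{\mathbf{V}}_{12}+\mathbf{A}_{KJ}\hat{\mathbf{V}}_{22}$, and for all $K$, $\mathbf{Q}_{KI}\leftarrow\mathbf{Q}_{KI}\hat{\mathbf{V}}_{11}+\mathbf{Q}_{KJ}\hat{\mathbf{V}}_{21}$, $\mathbf{Q}_{KJ}\leftarrow\mathbf{Q}_{KI}\hat{\mathbf{V}}_{12}+\mathbf{Q}_{KJ}\hat{\mathbf{V}}_{22}$. Each $B\times B$ product for the tile with coarse index $(R,T)$ is computed by 2.5D matrix multiplication over the $\mu\times\mu\times c$ grid $\mathrm{ProcSlab}(R,T,:)$; transposes of tiles are formed by swapping fine blocks within the tile. *)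

(* Defs.v *)
From HB Require Import structures.
From mathcomp Require Import all_boot all_order all_algebra.
From mathcomp Require Import reals exp.

Set Implicit Arguments.
Unset Strict Implicit.
Unset Printing Implicit Defensive.

Import Order.TTheory GRing.Theory Num.Theory.

Local Open Scope ring_scope.

Definition log2 (R : realType) (x : R) : R := ln x / ln 2.

(* Word counts w and matrix sizes k, N are arguments of the operations; in
   MatMul25 G N c, the processors G form a sqrt(#|G|/c) x sqrt(#|G|/c) x c
   grid and N is the size of the factors. *)
Inductive operation (T : finType) : Type :=
| Send (src dst : T) (w : nat)
| Scatter (root : T) (dests : {set T}) (w : nat)
| Gather (root : T) (srcs : {set T}) (w : nat)
| Bcast (root : T) (dests : {set T}) (w : nat)
| LocalMul (x : T) (k : nat)
| LocalAdd (x : T) (k : nat)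
| LocalDiag (x : T) (k : nat)
| MatMul25 (G : {set T}) (N c : nat).

Definition parts (T : finType) (o : operation T) : {set T} :=
  match o with
  | Send x y _ => [set x; y]
  | Scatter r D _ | Gather r D _ | Bcast r D _ => r |: D
  | LocalMul x _ | LocalAdd x _ | LocalDiag x _ => [set x]
  | MatMul25 G _ _ => G
  end.

(* The operations of one step do not depend on one another; the steps of a
   schedule are serially dependent through the processors they share. *)
Definition step (T : finType) := seq (operation T).
Definition schedule (T : finType) := seq (step T).

Definition par (T : finType) (ss : seq (schedule T)) : schedule T :=
  mkseq (fun k => flatten [seq nth [::] sch k | sch <- ss])
        (\max_(sch <- ss) size sch).

Record cost (R : realType) := Cost { msgs : R; words : R; flops : R }.

Definition leO (R : realType) (kappa x y : R) : Prop := 0 <= x <= kappa * y.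

(* kappa stands for the constants hidden in the O(.) of the cost model.  The
   formulas for collectives are those valid for at least as many words as
   participants; they are charged to every collective, so that a bound on the
   resulting cost needs no lower bound on the block sizes. *)
Definition cost_model (R : realType) (T : finType) (kappa : R)
    (charge : operation T -> cost R) : Prop :=
  forall o : operation T,
  let S := msgs (charge o) in
  let W := words (charge o) in
  let F := flops (charge o) in
  let p : R := #|parts o|%:R in
  match o with
  | Send _ _ w => [/\ leO kappa S 1, leO kappa W w%:R & F = 0]
  | Scatter _ _ w | Gather _ _ w => [/\ S = log2 p, W = w%:R & F = 0]
  | Bcast _ _ w => [/\ S = 2 * log2 p, W = 2 * w%:R & F = 0]
  | LocalMul _ k | LocalDiag _ k =>
      [/\ S = 0, W = 0 & leO kappa F (k%:R ^+ 3)]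
  | LocalAdd _ k => [/\ S = 0, W = 0 & F = k%:R ^+ 2]
  | MatMul25 _ N c =>
      (1 <= c)%N -> c%:R <= p `^ 3^-1 ->
      [/\ leO kappa S (Num.sqrt (p / c%:R ^+ 3) + log2 c%:R),
          leO kappa W (N%:R ^+ 2 / Num.sqrt (c%:R * p))
        & leO kappa F (N%:R ^+ 3 / p)]
  end.

(* A processor performs its own operations of a step one after the other. *)
Definition load (R : realType) (T : finType) (f : operation T -> R)
    (st : step T) (x : T) : R :=
  \sum_(o <- st | x \in parts o) f o.

Definition linked (T : finType) (st : step T) (x y : T) : bool :=
  (x == y) || has (fun o => (x \in parts o) && (y \in parts o)) st.

(* xs visits one processor per step, and moves from one processor to another
   only through an operation in which both take part. *)
Fixpoint dependency_chain (T : finType) (sch : schedule T) (xs : seq T) : bool :=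
  match sch, xs with
  | [::], [::] => true
  | st :: sch', x :: xs' =>
      (if xs' is y :: _ then linked st x y else true)
      && dependency_chain sch' xs'
  | _, _ => false
  end.

(* Applied to f := messages, words and flops of an operation, this gives S, W
   and F: each is maximized separately over all chains, hence dominates its
   value along any particular critical path. *)
Definition along_critical_path (R : realType) (T : finType)
    (f : operation T -> R) (sch : schedule T) : R :=
  \big[Num.max/0]_(xs : (size sch).-tuple T | dependency_chain sch xs)
     \sum_(sx <- zip sch xs) load f sx.1 sx.2.

(* 'I_q is 0-based whereas the indices 1 <= I < J <= q are 1-based. *)
Definition antidiag (q K : nat) : seq ('I_q * 'I_q) :=
  [seq IJ : 'I_q * 'I_q <- enum {: 'I_q * 'I_q}
     | (IJ.1 < IJ.2)%N && (IJ.1.+1 + IJ.2.+1 == K %[mod q])%N].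

Definition antidiag_list (q : nat) : seq (seq ('I_q * 'I_q)) :=
  [seq antidiag q K | K <- iota 0 q].

Section Numerics.
Variable R : realType.

Notation tiled q B := 'M[R]_(\sum_(i < q) B).

Definition tile (q B : nat) (A : tiled q B) (I J : 'I_q) : 'M[R]_B :=
  @submxblock R q q (fun=> B) (fun=> B) A I J.

Definition of_tiles (q B : nat) (E : 'I_q -> 'I_q -> 'M[R]_B) : tiled q B :=
  @mxblock R q q (fun=> B) (fun=> B) E.

Definition subproblem (q B : nat) (A : tiled q B) (I J : 'I_q) : 'M[R]_(B + B) :=
  block_mx (tile A I I) (tile A I J) (tile A J I) (tile A J J).

(* V_11, V_12, V_21, V_22 are ulsubmx V, ursubmx V, dlsubmx V, drsubmx V. *)
Definition update_A (q B : nat) (I J : 'I_q) (Ah V : 'M[R]_(B + B))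
    (A : tiled q B) : tiled q B :=
  of_tiles (fun K L =>
    if K == I then
      if L == I then ulsubmx Ah else if L == J then ursubmx Ah
      else (ulsubmx V)^T *m tile A I L + (dlsubmx V)^T *m tile A J L
    else if K == J then
      if L == I then dlsubmx Ah else if L == J then drsubmx Ah
      else (ursubmx V)^T *m tile A I L + (drsubmx V)^T *m tile A J L
    else if L == I then tile A K I *m ulsubmx V + tile A K J *m dlsubmx V
    else if L == J then tile A K I *m ursubmx V + tile A K J *m drsubmx V
    else tile A K L).

Definition update_Q (q B : nat) (I J : 'I_q) (V : 'M[R]_(B + B))
    (Q : tiled q B) : tiled q B :=
  of_tiles (fun K L =>
    if L == I then tile Q K I *m ulsubmx V + tile Q K J *m dlsubmx V
    else if L == J then tile Q K I *m ursubmx V + tile Q K J *m drsubmx V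
    else tile Q K L).

(* solve I J Ah Ah' V: the solver run on the subproblem Ah of the pair (I, J)
   may return Ah' and the orthogonal factor V.  The pairs of a group are
   disjoint: their subproblems do not interfere and their updates commute, so
   that treating them one after the other yields the result of treating them
   in parallel. *)
Fixpoint sweep_run (q B : nat)
    (solve : 'I_q -> 'I_q -> 'M[R]_(B + B) -> 'M[R]_(B + B) -> 'M[R]_(B + B) -> Prop)
    (l : seq ('I_q * 'I_q)) (A Q A' Q' : tiled q B) : Prop :=
  match l with
  | [::] => A' = A /\ Q' = Q
  | IJ :: l' =>
      exists Ah V, solve IJ.1 IJ.2 (subproblem A IJ.1 IJ.2) Ah V /\
        sweep_run solve l' (update_A IJ.1 IJ.2 Ah V A)
          (update_Q IJ.1 IJ.2 V Q) A' Q'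
  end.

Definition diagonalize (k : nat) (M D V : 'M[R]_k) : Prop :=
  [/\ V^T *m V = 1%:M, is_diag_mx D & M = V *m D *m V^T].

Fixpoint jacobi2D_run (s bh : nat) (k : nat) (M Q M' Q' : tiled s bh) : Prop :=
  match k with
  | 0 => M' = M /\ Q' = Q
  | k'.+1 => exists M1 Q1,
      sweep_run (fun _ _ => @diagonalize (bh + bh))
        (flatten (antidiag_list s)) M Q M1 Q1 /\
      jacobi2D_run k' M1 Q1 M' Q'
  end.

(* nsweeps I J is the number of sweeps of 2D parallel Jacobi applied to the
   subproblem of the pair (I, J), which occurs once in the list; any rule for
   stopping the iteration is allowed. *)
Definition jacobi25D_run (n q B s bh : nat) (en : n = (\sum_(I < q) B)%N)
    (eN : (B + B = \sum_(i < s) bh)%N) (nsweeps : 'I_q -> 'I_q -> nat)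
    (A Q A' Q' : 'M[R]_n) : Prop :=
  sweep_run
    (fun I J Ah Ah' V =>
       jacobi2D_run (nsweeps I J) (castmx (eN, eN) Ah) 1%:M
         (castmx (eN, eN) Ah') (castmx (eN, eN) V))
    (flatten (antidiag_list q))
    (castmx (en, en) A) (castmx (en, en) Q)
    (castmx (en, en) A') (castmx (en, en) Q').

End Numerics.

Definition exchange (T : finType) (x y : T) (w : nat) : step T :=
  [:: Send x y w; Send y x w].

Section Schedule2D.
(* ph i j is the processor in position (i, j) of the s x s grid; bh x bh is the
   size of its blocks. *)
Variables (T : finType) (s bh : nat) (ph : 'I_s -> 'I_s -> T).

Let w := (bh ^ 2)%N.

Definition jacobi2D_pair (ij : 'I_s * 'I_s) : schedule T :=
  let: (i, j) := ij in
  let ks := enum 'I_s in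
  let ks' := [seq k <- ks | (k != i) && (k != j)] in
  let row x := [set ph x k | k : 'I_s & k != x] in
  let col x := [set ph k x | k : 'I_s & k != x] in
  (* two products and one sum: one block of a block row or column times V *)
  let upd x := [:: LocalMul x bh; LocalMul x bh; LocalAdd x bh] in
  [:: [:: Send (ph i i) (ph i j) w; Send (ph j j) (ph i j) w];
      [:: LocalDiag (ph i j) (2 * bh)%N];
      (* V_11, V_21, D_11, resp. V_12, V_22, D_22, resp. D_21 *)
      [:: Send (ph i j) (ph i i) (3 * w)%N; Send (ph i j) (ph j j) (3 * w)%N;
          Send (ph i j) (ph j i) w];
      (* rows of M; columns of M; columns of Q *)
      flatten [seq exchange (ph i k) (ph j k) w
                   ++ exchange (ph k i) (ph k j) w
                   ++ exchange (ph k i) (ph k j) w | k <- ks];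
      flatten [seq [:: Bcast (ph x x) (row x) w; Bcast (ph x x) (row x) w;
                       Bcast (ph x x) (col x) w; Bcast (ph x x) (col x) w]
              | x <- [:: i; j]];
      flatten [seq upd (ph i k) ++ upd (ph j k) | k <- ks'];
      flatten [seq upd (ph k i) ++ upd (ph k j) | k <- ks'];
      flatten [seq upd (ph k i) ++ upd (ph k j) | k <- ks]].

Definition jacobi2D_sweep : schedule T :=
  flatten [seq par [seq jacobi2D_pair ij | ij <- g] | g <- antidiag_list s].

End Schedule2D.

(* The side of the grid is q * mu: q coarse tiles, each mu processors wide. *)
Definition proc (q mu c : nat) : finType :=
  ('I_(q * mu) * 'I_(q * mu) * 'I_c)%type.

Lemma grid_index_proof (q mu : nat) (I : 'I_q) (u : 'I_mu) :
  (I * mu + u < q * mu)%N.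
Proof.
apply: (@leq_trans (I * mu + mu)); first by rewrite ltn_add2l.
by rewrite -mulSnr leq_mul2r (ltn_ord I) orbT.
Qed.

Definition grid_index (q mu : nat) (I : 'I_q) (u : 'I_mu) : 'I_(q * mu) :=
  Ordinal (grid_index_proof I u).

(* the processor in position (u, v) of the coarse tile (I, J) of layer r *)
Definition at_tile (q mu c : nat) (I J : 'I_q) (u v : 'I_mu) (r : 'I_c) :
    proc q mu c :=
  (grid_index I u, grid_index J v, r).

Definition ProcTile (q mu c : nat) (I J : 'I_q) (r : 'I_c) : {set proc q mu c} :=
  [set at_tile I J u v r | u : 'I_mu, v : 'I_mu].

(* ProcSlab(I, J, :) *)
Definition slab_layers (q mu c : nat) (I J : 'I_q) : {set proc q mu c} :=
  \bigcup_(r < c) ProcTile mu I J r.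

(* ProcSlab(:, [I,J], :) *)
Definition slab_columns (q mu c : nat) (I J : 'I_q) : {set proc q mu c} :=
  \bigcup_(K < q) (slab_layers mu c K I :|: slab_layers mu c K J).

(* phat I J arranges processors of ProcSlab(:, [I,J], :) as an s x s grid. *)
Definition placement (q mu c s : nat)
    (phat : 'I_q -> 'I_q -> 'I_s -> 'I_s -> proc q mu c) : Prop :=
  forall I J : 'I_q, (I < J)%N ->
    injective (fun xy => phat I J xy.1 xy.2) /\
    forall x y, phat I J x y \in slab_columns mu c I J.

Section Schedule25D.
(* b is the size of the fine tiles, bh that of the blocks of the subproblems on
   their s x s grids; a fine tile is cut into t x t blocks of size bh. *)
Variables (q mu c s b bh t : nat) (c_gt0 : (0 < c)%N).
Variable phat : 'I_q -> 'I_q -> 'I_s -> 'I_s -> proc q mu c.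
Variable nsweeps : 'I_q -> 'I_q -> nat.

Notation T := (proc q mu c).

Let B := (mu * b)%N.
Let w := (b ^ 2)%N.
Let top : 'I_c := Ordinal c_gt0.
Let at1 (I J : 'I_q) (u v : 'I_mu) : T := at_tile I J u v top.

Definition each_pos (f : 'I_mu -> 'I_mu -> step T) : step T :=
  flatten [seq f uv.1 uv.2 | uv <- enum {: 'I_mu * 'I_mu}].

(* Within the 2mu x 2mu fine tiles of the subproblem of (I, J), the one owned
   by at1 R C u v has row index (R == J) * mu + u. *)
Definition block_owners (I J R C : 'I_q) (u v : 'I_mu) : {set T} :=
  [set phat I J xy.1 xy.2 | xy : 'I_s * 'I_s
     & (xy.1 %/ t == (R == J) * mu + u)%N && (xy.2 %/ t == (C == J) * mu + v)%N].

Definition subproblem_tiles (I J : 'I_q) (f : 'I_q -> 'I_q -> 'I_mu -> 'I_mu -> step T) :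
    step T :=
  flatten [seq each_pos (f RC.1 RC.2)
          | RC <- [:: (I, I); (I, J); (J, I); (J, J)]].

Definition scatter_subproblem (IJ : 'I_q * 'I_q) : schedule T :=
  let I := IJ.1 in let J := IJ.2 in
  [:: subproblem_tiles I J (fun R C u v =>
        [:: Scatter (at1 R C u v) (block_owners I J R C u v) w])].

Definition solve_subproblem (IJ : 'I_q * 'I_q) : schedule T :=
  let I := IJ.1 in let J := IJ.2 in
  flatten (nseq (nsweeps I J) (jacobi2D_sweep bh (phat I J))).

(* A product of tiles transposed beforehand, or of untransposed tiles, for the
   tile of index (R, C); the sum of two products is formed on the top layer. *)
Definition tile_update (R C : 'I_q) : step T :=
  [:: MatMul25 (slab_layers mu c R C) B c; MatMul25 (slab_layers mu c R C) B c]
  ++ each_pos (fun u v => [:: LocalAdd (at1 R C u v) b]).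

(* Both blocks of V held by the tile (R, C) are transposed; each fine tile
   outside the diagonal goes to the mirror position. *)
Definition tile_transposes (R C : 'I_q) : step T :=
  each_pos (fun u v => if u == v then [::] else
    [:: Send (at1 R C u v) (at1 R C v u) w;
        Send (at1 R C u v) (at1 R C v u) w]).

Definition gather_and_update (IJ : 'I_q * 'I_q) : schedule T :=
  let I := IJ.1 in let J := IJ.2 in
  let Ks := enum 'I_q in
  let Ks' := [seq K <- Ks | (K != I) && (K != J)] in
  let row X u v := [set at1 X K u v | K : 'I_q & K != X] in
  let col X u v := [set at1 K X u v | K : 'I_q & K != X] in
  [:: subproblem_tiles I J (fun R C u v =>
        [:: Gather (at1 R C u v) (block_owners I J R C u v) w;
            Gather (at1 R C u v) (block_owners I J R C u v) w]);
      each_pos (fun u v =>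
        [:: Send (at1 J I u v) (at1 I I u v) w;
            Send (at1 I J u v) (at1 J J u v) w]);
      flatten [seq each_pos (fun u v =>
        exchange (at1 I K u v) (at1 J K u v) w
        ++ exchange (at1 K I u v) (at1 K J u v) w) | K <- Ks']
      ++ flatten [seq each_pos (fun u v =>
        exchange (at1 K I u v) (at1 K J u v) w) | K <- Ks];
      flatten [seq each_pos (fun u v =>
        [:: Bcast (at1 X X u v) (row X u v) w; Bcast (at1 X X u v) (row X u v) w;
            Bcast (at1 X X u v) (col X u v) w; Bcast (at1 X X u v) (col X u v) w])
        | X <- [:: I; J]];
      flatten [seq tile_transposes I K ++ tile_transposes J K | K <- Ks'];
      flatten [seq tile_update I K ++ tile_update J K | K <- Ks'];
      flatten [seq tile_update K I ++ tile_update K J | K <- Ks'];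
      flatten [seq tile_update K I ++ tile_update K J | K <- Ks]].

Definition jacobi25D_sweep : schedule T :=
  flatten [seq par [seq scatter_subproblem IJ | IJ <- g]
               ++ par [seq solve_subproblem IJ | IJ <- g]
               ++ par [seq gather_and_update IJ | IJ <- g]
          | g <- antidiag_list q].

End Schedule25D.

(* Main.v *)
Require Import Defs.
From mathcomp Require Import all_boot all_order all_algebra.
From mathcomp Require Import reals exp.
From mathcomp Require Import zify ring lra.

(**
The index pairs of an antidiagonal group are disjoint, so in every step each
processor takes part in a bounded number of operations, and a critical path
costs at most a constant times the sum over the steps of the largest cost of a
single operation.  With X ~ q s / sqrt 2 (the subproblem grid is s x s, there
are q groups) the q * s * O(1) steps of the 2D solver, on blocks of size
bh = 2n/(qs), contribute O(X log s), O(n^2/X) and O(n^3/X^2); the O(q) other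
steps work on tiles of size B = n/q, and contribute O(q log q + X log s),
q B^2/(c mu) = n^2/sqrt(cP) and q B^3/(mu^2 c) = n^3/P.
*)

Set Implicit Arguments.
Unset Strict Implicit.
Unset Printing Implicit Defensive.

Import Order.TTheory GRing.Theory Num.Theory.
Local Open Scope ring_scope.

(** * Sums of indicators over finite types *)

Lemma all_flatten (S : Type) (a : pred S) (ss : seq (seq S)) :
  all a (flatten ss) = all (all a) ss.
Proof. by elim: ss => //= s ss IH; rewrite all_cat IH. Qed.

Lemma sum_le1 (I : finType) (P : pred I) :
  (forall i j, P i -> P j -> i = j) -> (\sum_i P i <= 1)%N.
Proof.
move=> Puniq; case: (pickP P) => [i Pi|no].
  rewrite (bigD1 i) //= big1 ?addn0 ?leq_b1 // => j ji.
  by case Pj : (P j) => //; rewrite (Puniq j i) ?eqxx in ji.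
by rewrite big1 // => i _; rewrite no.
Qed.

Lemma sum_ord_eq (q e : nat) : (\sum_(i < q) (val i == e) <= 1)%N.
Proof. by apply: sum_le1 => i j /eqP <- /eqP /val_inj. Qed.

Lemma sum_uniq_le (I : finType) (l : seq I) (F : I -> nat) : uniq l ->
  (\sum_(i <- l) F i <= \sum_i F i)%N.
Proof.
by move=> ul; rewrite big_uniq //= big_mkcond leq_sum // => i _; case: ifP.
Qed.

(** * Steps of bounded degree and their composition *)

Section Schedules.
Variable T : finType.
Implicit Types (p : pred (operation T)) (Z : {set T}) (st : step T).

Definition degree st (x : T) : nat := count (fun o => x \in parts o) st.

Definition confined p Z st : bool := all (fun o => p o && (parts o \subset Z)) st.

(** The predicate [p] bounds the cost of each operation and [k] their number at each processor,
    which together bound the load. The territory [Z] is carried along so that steps run in parallel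
    can be combined. *)
Definition fits p Z (k : nat) st : bool :=
  confined p Z st && [forall x, (degree st x <= k)%N].

Lemma degree_notin p Z st x : confined p Z st -> x \notin Z -> degree st x = 0%N.
Proof.
rewrite /confined /degree; elim: st => //= o st IH /andP[/andP[_ oZ] cst] xZ.
by rewrite IH // addn0; case: (boolP (x \in parts o)) => // /(subsetP oZ); rewrite (negPf xZ).
Qed.

Lemma fits_le p Z k k' st : (k <= k')%N -> fits p Z k st -> fits p Z k' st.
Proof.
move=> kk /andP[c /forallP d]; apply/andP; split=> //.
by apply/forallP => x; apply: leq_trans (d x) kk.
Qed.

Lemma fits_size p Z k st : confined p Z st -> (size st <= k)%N -> fits p Z k st.
Proof.
move=> c sk; apply/andP; split=> //; apply/forallP => x.
exact: leq_trans (count_size _ _) sk.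
Qed.

Lemma fits_cat p Z k1 k2 st1 st2 :
  fits p Z k1 st1 -> fits p Z k2 st2 -> fits p Z (k1 + k2) (st1 ++ st2).
Proof.
move=> /andP[c1 /forallP d1] /andP[c2 /forallP d2].
rewrite /fits /confined all_cat; apply/andP; split; first exact/andP.
by apply/forallP => x; rewrite /degree count_cat leq_add ?d1 ?d2.
Qed.

(* The territories Y i may overlap, provided that no processor lies in more
   than d of them. *)
Lemma fits_flatten (I : eqType) (l : seq I) (F : I -> step T) (Y : I -> {set T})
    p Z k d :
  (forall i, i \in l -> fits p (Z :&: Y i) k (F i)) ->
  (forall x, (\sum_(i <- l) (x \in Y i) <= d)%N) ->
  fits p Z (d * k) (flatten [seq F i | i <- l]).
Proof.
move=> hF hd; apply/andP; split.
  rewrite /confined all_flatten all_map; apply/allP => i il /=.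
  have /andP[ci _] := hF i il.
  apply: sub_all ci => o /andP[-> /=].
  by rewrite subsetI => /andP[].
apply/forallP => x; apply: (@leq_trans ((\sum_(i <- l) (x \in Y i)) * k)); last first.
  by rewrite leq_mul2r hd orbT.
rewrite /degree count_flatten -map_comp sumnE big_map big_distrl /=.
rewrite big_seq [leqRHS]big_seq; apply: leq_sum => i il.
have /andP[ci /forallP di] := hF i il.
case: (boolP (x \in Y i)) => xY; first by rewrite mul1n; apply: di.
by rewrite -[count _ _]/(degree (F i) x) (degree_notin ci) // inE negb_and xY orbT.
Qed.

(** Each step of [par] concatenates steps of the component schedules, so the bound on a single step
    from [fits_flatten] applies to it. *)
Lemma par_fits (I : eqType) (l : seq I) (sch : I -> schedule T)
    (Y : I -> {set T}) p Z k d :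
  (forall i, i \in l -> all (fits p (Z :&: Y i) k) (sch i)) ->
  (forall x, (\sum_(i <- l) (x \in Y i) <= d)%N) ->
  all (fits p Z (d * k)) (par [seq sch i | i <- l]).
Proof.
move=> hsch hd; rewrite /par /mkseq all_map; apply/allP => j _ /=.
rewrite -map_comp; apply: fits_flatten hd => i il /=.
case: (ltnP j (size (sch i))) => [js|js]; first exact: (all_nthP _ (hsch i il)).
(* A schedule that has ended contributes the empty step, which fits every bound. *)
by rewrite nth_default //; apply: fits_size.
Qed.

Lemma size_par (I : eqType) (l : seq I) (sch : I -> schedule T) N :
  (forall i, i \in l -> (size (sch i) <= N)%N) ->
  (size (par [seq sch i | i <- l]) <= N)%N.
Proof.
move=> h; rewrite size_mkseq big_map; apply/bigmax_leqP_seq => i il _; exact: h.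
Qed.

Lemma size_flatten_le (I : eqType) (l : seq I) (sch : I -> schedule T) N :
  (forall i, i \in l -> (size (sch i) <= N)%N) ->
  (size (flatten [seq sch i | i <- l]) <= size l * N)%N.
Proof.
move=> h; rewrite size_flatten /shape -map_comp sumnE big_map.
rewrite -sum1_size big_distrl /= big_seq [leqRHS]big_seq.
by apply: leq_sum => i il; rewrite mul1n h.
Qed.

(** * Cost accumulated along a path *)

Section Paths.
Variable R : realType.
Implicit Types (f : operation T -> R) (sch : schedule T).

(** All sequences of processors are allowed, not only dependency chains. The bound is thus stronger,
    and it splits at a concatenation of schedules without tracking the link between the two
    halves. *)
Definition path_le f sch (beta : R) : Prop :=
  forall xs, size xs = size sch ->
    \sum_(sx <- zip sch xs) load f sx.1 sx.2 <= beta.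

Lemma critical_path_le f sch beta : 0 <= beta -> path_le f sch beta ->
  along_critical_path f sch <= beta.
Proof.
move=> b0 h; rewrite /along_critical_path; apply: bigmax_le => // xs _.
by apply: h; rewrite size_tuple.
Qed.

Lemma path_le_cat f sch1 sch2 b1 b2 : path_le f sch1 b1 -> path_le f sch2 b2 ->
  path_le f (sch1 ++ sch2) (b1 + b2).
Proof.
move=> h1 h2 xs; rewrite size_cat => sxs.
have s1 : size (take (size sch1) xs) = size sch1 by rewrite size_take sxs; case: ltnP; lia.
rewrite -(cat_take_drop (size sch1) xs) zip_cat //.
by rewrite big_cat lerD ?h1 ?h2 // size_drop sxs addKn.
Qed.

Lemma path_le_flatten (I : eqType) (l : seq I) (sch : I -> schedule T) f beta :
  (forall i, i \in l -> path_le f (sch i) beta) ->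
  path_le f (flatten [seq sch i | i <- l]) ((size l)%:R * beta).
Proof.
elim: l => [_ [] // _|i l IH h] /=; first by rewrite big_nil mul0r.
rewrite mulrSr mulrDl mul1r addrC; apply: path_le_cat; first by apply: h; rewrite mem_head.
by apply: IH => j jl; apply: h; rewrite inE jl orbT.
Qed.

Lemma load_le f p Z k st beta x : 0 <= beta -> (forall o, p o -> f o <= beta) ->
  fits p Z k st -> load f st x <= k%:R * beta.
Proof.
move=> b0 hf /andP[c /forallP/(_ x) d].
apply: (@le_trans _ _ ((degree st x)%:R * beta)); last first.
  by rewrite ler_wpM2r // ler_nat.
rewrite /load /degree; elim: st c {d} => [|o st IH] /= c.
  by rewrite big_nil mul0r.
case/andP: c => /andP[po _] c; rewrite big_cons natrD mulrDl.
case: ifP => _ /=; last by rewrite mul0r add0r IH.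
by rewrite mul1r lerD ?hf ?IH.
Qed.

Lemma path_le_fits f p Z k N sch beta : 0 <= beta -> (forall o, p o -> f o <= beta) ->
  all (fits p Z k) sch -> (size sch <= N)%N -> path_le f sch (N%:R * (k%:R * beta)).
Proof.
move=> b0 hf a sN xs sxs.
apply: (@le_trans _ _ ((size sch)%:R * (k%:R * beta))); last first.
  by rewrite ler_wpM2r ?mulr_ge0 // ler_nat.
elim: sch xs a sxs {sN} => [|st sch IH] [|x xs] //=; first by rewrite big_nil mul0r.
move=> /andP[fs a] [sxs]; rewrite big_cons mulrSr mulrDl mul1r addrC.
by apply: lerD; [apply: IH | apply: load_le fs].
Qed.

End Paths.
End Schedules.

(** * Disjointness of the pairs of an anti-diagonal group *)

Section Antidiagonals.
Variables q K : nat.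

Lemma antidiag_lt (IJ : 'I_q * 'I_q) : IJ \in antidiag q K -> (IJ.1 < IJ.2)%N.
Proof. by rewrite mem_filter => /andP[/andP[]]. Qed.

Lemma eq_mod_ord (e : nat) (i j : 'I_q) :
  (e + i.+1 = e + j.+1 %[mod q])%N -> i = j.
Proof.
move/eqP; rewrite eqn_modDl -[i.+1]addn1 -[j.+1]addn1 eqn_modDr !modn_small // => /eqP.
exact: val_inj.
Qed.

(** The sum of a pair is fixed modulo [q], so either index determines the other. This gives distinct
    first indices and distinct second indices. *)
Lemma uniq_antidiag :
  uniq ([seq IJ.1 | IJ <- antidiag q K] ++ [seq IJ.2 | IJ <- antidiag q K]).
Proof.
have mm (x y : 'I_q * 'I_q) : x \in antidiag q K -> y \in antidiag q K ->
    (x.1.+1 + x.2.+1 = y.1.+1 + y.2.+1 %[mod q])%N.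
  by rewrite !mem_filter => /andP[/andP[_ /eqP->] _] /andP[/andP[_ /eqP->] _].
have u : uniq (antidiag q K) by rewrite filter_uniq // enum_uniq.
rewrite cat_uniq; apply/and3P; split.
- rewrite map_inj_in_uniq // => -[i j] [i' j'] /= xl yl ii.
  by have := mm _ _ xl yl; rewrite /= ii => /eq_mod_ord ->.
(* If [j] is second in [(i, j)] and first in [(j, j')], equal sums force [i = j'], against
   [i < j < j']. *)
- apply/hasPn => _ /mapP[[i j] xl ->] /=; apply/negP => /mapP[[i' j'] yl /= ji].
  have := mm _ _ xl yl; have := antidiag_lt xl; have := antidiag_lt yl => /=.
  rewrite -ji [(i.+1 + _)%N]addnC => h1 h2 /eq_mod_ord e; move: h1; rewrite -e; lia.
- rewrite map_inj_in_uniq // => -[i j] [i' j'] /= xl yl ii.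
  by have := mm _ _ xl yl; rewrite /= ii ![(_ + j'.+1)%N]addnC => /eq_mod_ord ->.
Qed.

Lemma antidiag_sum (h : 'I_q -> nat) :
  (\sum_(IJ <- antidiag q K) (h IJ.1 + h IJ.2) <= \sum_a h a)%N.
Proof.
rewrite big_split /=.
have -> : (\sum_(IJ <- antidiag q K) h IJ.1 + \sum_(IJ <- antidiag q K) h IJ.2 =
  \sum_(a <- [seq IJ.1 | IJ <- antidiag q K] ++ [seq IJ.2 | IJ <- antidiag q K]) h a)%N.
  by rewrite big_cat !big_map.
exact/sum_uniq_le/uniq_antidiag.
Qed.

(** No index occurs twice in a group, so the territories of its pairs overlap no more than those of
    single indices. The number of pairs does not enter the bound. *)
Lemma antidiag_cover (T : finType) (Y : 'I_q -> {set T}) d x :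
  (\sum_a (x \in Y a) <= d)%N ->
  (\sum_(IJ <- antidiag q K) (x \in Y IJ.1 :|: Y IJ.2) <= d)%N.
Proof.
apply: leq_trans; apply: leq_trans (antidiag_sum (fun a => x \in Y a)).
by apply: leq_sum => IJ _; rewrite inE; do 2!case: (x \in _).
Qed.

End Antidiagonals.

(** * Two-dimensional Jacobi *)

Section Jacobi2D.
Variables (T : finType) (s bh : nat) (ph : 'I_s -> 'I_s -> T) (Z : {set T}).
Hypotheses (ph_inj : injective (fun xy : 'I_s * 'I_s => ph xy.1 xy.2))
  (phZ : forall x y, ph x y \in Z).

(** Only the sizes that determine costs are recorded. The factor 3 is the message carrying two
    blocks of V and one of D; the factor 2 is the side of the locally diagonalized matrix. *)
Definition jacobi2D_op (o : operation T) : bool :=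
  match o with
  | Send _ _ w => (w <= 3 * bh ^ 2)%N
  | Bcast _ D w => (#|D| <= s)%N && (w <= bh ^ 2)%N
  | LocalMul _ k | LocalAdd _ k => (k <= bh)%N
  | LocalDiag _ k => (k <= 2 * bh)%N
  | _ => false
  end.

(** The territory of one index: row [a] and column [a] of the grid. All work for a pair lies in the
    crosses of its two indices. *)
Definition cross (a : 'I_s) : {set T} :=
  [set x | [exists k, (x == ph a k) || (x == ph k a)]].

Lemma cross_row a k : ph a k \in cross a.
Proof. by rewrite inE; apply/existsP; exists k; rewrite eqxx. Qed.

Lemma cross_col a k : ph k a \in cross a.
Proof. by rewrite inE; apply/existsP; exists k; rewrite eqxx orbT. Qed.

(** By injectivity of [ph], the processor at position (a, b) lies only in the crosses of [a] and
    [b]; a processor outside the grid lies in none. *)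
Lemma sum_cross x : (\sum_a (x \in cross a) <= 2)%N.
Proof.
case: (pickP (fun ab : 'I_s * 'I_s => x == ph ab.1 ab.2)) => [[a b] /= /eqP->|no].
  have inj u v u' v' : ph u v = ph u' v' -> u = u' /\ v = v'.
    by move=> /(@ph_inj (u, v) (u', v')) [].
  apply: (@leq_trans (\sum_(e : 'I_s) ((val e == a) + (val e == b)))); last first.
    by rewrite big_split (leq_add (sum_ord_eq _ _) (sum_ord_eq _ _)).
  apply: leq_sum => e _; rewrite inE; case: existsP => //= -[k].
  by case/orP=> /eqP/inj [-> ->]; rewrite eqxx ?addn1.
rewrite big1 // => a _; rewrite inE; case: existsP => // -[k].
by rewrite (no (a, k)) (no (k, a)).
Qed.

Lemma jacobi2D_pair_fits (ij : 'I_s * 'I_s) :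
  all (fits jacobi2D_op (Z :&: (cross ij.1 :|: cross ij.2)) 12)
    (jacobi2D_pair bh ph ij).
Proof.
case: ij => i j; rewrite /jacobi2D_pair /=.
set C := cross i :|: cross j.
pose inC := (in_setI, in_setU, phZ, cross_row, cross_col, orbT).
have w3 : (bh ^ 2 <= 3 * bh ^ 2)%N by rewrite leq_pmull.
have card_im (F : 'I_s -> T) (P : pred 'I_s) : (#|[set F k | k : 'I_s & P k]| <= s)%N.
  by rewrite (leq_trans (leq_imset_card _ _)) // (leq_trans (max_card _)) ?card_ord.
(* The operations for [k] stay in the cross of [k]. There are at most 6 of them (three exchanges, or
   two updates of three operations), and crosses overlap at most twice, whence 12. *)
have over_k (l : seq 'I_s) (F : 'I_s -> step T) : uniq l ->
    (forall k, fits jacobi2D_op (Z :&: C :&: cross k) 6 (F k)) ->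
    fits jacobi2D_op (Z :&: C) 12 (flatten [seq F k | k <- l]).
  move=> ul hF; apply: (@fits_flatten _ _ _ _ cross _ _ 6 2) => // x.
  exact: leq_trans (sum_uniq_le _ ul) (sum_cross x).
have uks : uniq (enum 'I_s) by exact: enum_uniq.
have uks' : uniq [seq k <- enum 'I_s | (k != i) && (k != j)] by exact: filter_uniq.
apply/and5P; split; last (apply/and5P; split=> //).
- by apply: fits_size; rewrite // /confined /= !subUset !sub1set !inC w3.
- by apply: fits_size; rewrite // /confined /= !sub1set !inC leqnn.
- by apply: fits_size; rewrite // /confined /= !subUset !sub1set !inC w3 leqnn.
- apply: over_k => // k; apply: fits_size => //.
  by rewrite /confined /= !subUset !sub1set !inC w3.
- apply: fits_size => //; rewrite /confined /= !subUset !sub1set !inC !card_im leqnn /=.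
  have sub (F : 'I_s -> T) (P : pred 'I_s) : (forall k, F k \in Z :&: C) ->
      [set F k | k : 'I_s & P k] \subset Z :&: C.
    by move=> h; apply/subsetP => _ /imsetP[k _ ->].
  by rewrite !sub //= => k; rewrite !inC.
- apply: over_k => // k; apply: fits_size => //.
  by rewrite /confined /= !sub1set !inC leqnn.
- apply: over_k => // k; apply: fits_size => //.
  by rewrite /confined /= !sub1set !inC leqnn.
- apply: over_k => // k; apply: fits_size => //.
  by rewrite /confined /= !sub1set !inC leqnn.
Qed.

Lemma jacobi2D_sweep_fits : all (fits jacobi2D_op Z 24) (jacobi2D_sweep bh ph).
Proof.
rewrite all_flatten all_map; apply/allP => g /mapP[K _ ->] /=.
(* Parallel pairs again overlap at most twice at a processor: 24 = 2 * 12. *)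
apply: (@par_fits _ _ _ _ (fun ij => cross ij.1 :|: cross ij.2) _ _ 12 2) => [ij _|x].
  exact: jacobi2D_pair_fits.
exact/antidiag_cover/sum_cross.
Qed.

Lemma size_jacobi2D_sweep : (size (jacobi2D_sweep bh ph) <= s * 8)%N.
Proof.
rewrite -[X in (X * 8)%N](size_iota 0) -(size_map (antidiag s)).
by apply: size_flatten_le => g _; apply: size_par => -[].
Qed.

End Jacobi2D.

(** * The 2.5D schedule *)

Section Jacobi25D.
Variables (q mu c s b bh t : nat) (c_gt0 : (0 < c)%N).
Variable phat : 'I_q -> 'I_q -> 'I_s -> 'I_s -> proc q mu c.
Variable nsweeps : 'I_q -> 'I_q -> nat.
Hypothesis phat_placed : placement phat.

Notation T := (proc q mu c).

(** The owners of a fine tile are bounded crudely by the whole subproblem grid, since their number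
    only enters through a logarithm. *)
Definition jacobi25D_op (o : operation T) : bool :=
  match o with
  | Scatter _ D w | Gather _ D w => (#|D| <= s ^ 2)%N && (w <= b ^ 2)%N
  | Send _ _ w => (w <= b ^ 2)%N
  | Bcast _ D w => (#|D| <= q)%N && (w <= b ^ 2)%N
  | LocalAdd _ k => (k <= b)%N
  | MatMul25 G N c' => [&& #|G| == (mu * mu * c)%N, N == (mu * b)%N & c' == c]
  | _ => false
  end.

(** The coarse analogue of [cross], taken over all layers, so that it also covers the processors
    lent by [phat] to the subproblems and the grids of the 2.5D products. *)
Definition tile_cross (a : 'I_q) : {set T} :=
  [set x : T | (x.1.1 %/ mu == a)%N || (x.1.2 %/ mu == a)%N].

(** A second family of territories: transfers between coarse tiles keep the position inside the
    tile, and transposes mirror it. *)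
Definition position (uv : 'I_mu * 'I_mu) : {set T} :=
  [set x : T | (x.1.1 %% mu == uv.1)%N && (x.1.2 %% mu == uv.2)%N].

Lemma grid_index_div (I : 'I_q) (u : 'I_mu) : (grid_index I u %/ mu = I)%N.
Proof. by rewrite /= divnMDl ?divn_small ?addn0 // (leq_ltn_trans _ (ltn_ord u)). Qed.

Lemma grid_index_mod (I : 'I_q) (u : 'I_mu) : (grid_index I u %% mu = u)%N.
Proof. by rewrite /= modnMDl modn_small. Qed.

Lemma at_tile_cross I J u v (r : 'I_c) a :
  (at_tile I J u v r \in tile_cross a) = (I == a) || (J == a).
Proof. by rewrite inE !grid_index_div. Qed.

Lemma at_tile_position I J u v (r : 'I_c) uv :
  (at_tile I J u v r \in position uv) = (u == uv.1) && (v == uv.2).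
Proof. by rewrite inE !grid_index_mod. Qed.

Lemma sum_tile_cross x : (\sum_a (x \in tile_cross a) <= 2)%N.
Proof.
apply: (@leq_trans (\sum_(a : 'I_q)
    ((val a == x.1.1 %/ mu)%N + (val a == x.1.2 %/ mu)%N))); last first.
  by rewrite big_split (leq_add (sum_ord_eq _ _) (sum_ord_eq _ _)).
by apply: leq_sum => a _; rewrite inE ![_ == val a]eq_sym; do 2!case: (_ == _).
Qed.

Lemma sum_position x : (\sum_uv (x \in position uv) <= 1)%N.
Proof.
apply: sum_le1 => -[u v] [u' v']; rewrite !inE /=.
move=> /andP[/eqP eu /eqP ev] /andP[/eqP eu' /eqP ev'].
by congr (_, _); apply: val_inj; rewrite /= -?eu -?ev ?eu' ?ev'.
Qed.

Lemma slab_layersE (I J : 'I_q) : slab_layers mu c I J =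
  [set at_tile I J z.1.1 z.1.2 z.2 | z : 'I_mu * 'I_mu * 'I_c].
Proof.
apply/setP => x; apply/bigcupP/imsetP => [[r _ /imset2P[u v _ _ ->]]|[[[u v] r] _ ->]].
  by exists (u, v, r).
by exists r => //; apply/imset2P; exists u v.
Qed.

Lemma card_slab_layers (I J : 'I_q) : #|slab_layers mu c I J| = (mu * mu * c)%N.
Proof.
rewrite slab_layersE card_imset ?card_prod ?card_ord //.
move=> [[u v] r] [[u' v'] r'] [] /= /(addnI)/val_inj -> /(addnI)/val_inj ->.
by move=> ->.
Qed.

Lemma slab_layers_sub (I J : 'I_q) (Y : {set T}) :
  (forall u v r, at_tile I J u v r \in Y) -> slab_layers mu c I J \subset Y.
Proof. by move=> h; rewrite slab_layersE; apply/subsetP => _ /imsetP[z _ ->]. Qed.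

Lemma slab_columns_sub (I J : 'I_q) :
  slab_columns mu c I J \subset tile_cross I :|: tile_cross J.
Proof.
apply/bigcupsP => K _; rewrite subUset !slab_layers_sub // => u v r.
  by rewrite in_setU !at_tile_cross eqxx !orbT.
by rewrite in_setU !at_tile_cross eqxx !orbT.
Qed.

Lemma fits_each_pos (f : 'I_mu -> 'I_mu -> step T) (Y : 'I_mu * 'I_mu -> {set T})
    (p : pred (operation T)) Z k d :
  (forall u v, fits p (Z :&: Y (u, v)) k (f u v)) ->
  (forall x, (\sum_uv (x \in Y uv) <= d)%N) ->
  fits p Z (d * k) (each_pos f).
Proof.
move=> hf hd; apply: (@fits_flatten _ _ _ _ Y _ _ k d) => [[u v] _|x]; first exact: hf.
by rewrite big_enum.
Qed.

Section Pair.
Variables I J : 'I_q.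
Hypothesis IJ : (I < J)%N.

Let Z : {set T} := tile_cross I :|: tile_cross J.

Lemma phat_inj : injective (fun xy : 'I_s * 'I_s => phat I J xy.1 xy.2).
Proof. by case: (phat_placed IJ). Qed.

Lemma phat_cross x y : phat I J x y \in Z.
Proof. by have [_ h] := phat_placed IJ; exact: (subsetP (slab_columns_sub I J)). Qed.

(** By injectivity of [phat] a processor has one place in the subproblem grid, and the quotients of
    its coordinates by [t] determine the fine tile. *)
Lemma sum_block_owners R C x :
  (\sum_(uv : 'I_mu * 'I_mu) (x \in block_owners t phat I J R C uv.1 uv.2) <= 1)%N.
Proof.
apply: sum_le1 => -[u v] [u' v'] /= /imsetP[xy].
rewrite inE => /andP[/eqP ex /eqP ey] -> /imsetP[xy'].
rewrite inE => /andP[/eqP ex' /eqP ey'] /phat_inj e.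
move: ex ey; rewrite e ex' ey' => /addnI/val_inj -> /addnI/val_inj ->.
by [].
Qed.

(** For each of the four coarse tiles, a processor can be involved at one position as root and in
    one set of block owners, hence 4 * 2. The four tiles are not separated from one another: each
    gets the full territory [setT]. *)
Lemma subproblem_tiles_fits f k :
  (forall R C u v, (R == I) || (R == J) -> (C == I) || (C == J) ->
    fits jacobi25D_op
      (Z :&: (position (u, v) :|: block_owners t phat I J R C u v)) k (f R C u v)) ->
  fits jacobi25D_op Z (4 * (2 * k)) (subproblem_tiles I J f).
Proof.
move=> hf; apply: (@fits_flatten _ _ _ _ (fun=> setT) _ _ (2 * k) 4) => [[R C] RC|x].
  have {RC} [hR hC] : (R == I) || (R == J) /\ (C == I) || (C == J).
    by move: RC; rewrite !inE => /or4P[] /eqP[-> ->]; rewrite ?eqxx ?orbT.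
  rewrite setIT; apply: (fits_each_pos (Y := fun uv => position uv :|:
     block_owners t phat I J R C uv.1 uv.2)) => [u v|x]; first exact: hf.
  apply: leq_trans (leq_add (sum_position x) (sum_block_owners R C x)).
  rewrite -big_split; apply: leq_sum => uv _; rewrite inE.
  by do 2!case: (_ \in _).
by rewrite !big_cons big_nil !in_setT.
Qed.

Lemma card_block_owners R C u v :
  (#|block_owners t phat I J R C u v| <= s ^ 2)%N.
Proof.
apply: leq_trans (leq_imset_card _ _) _; apply: leq_trans (max_card _) _.
by rewrite card_prod card_ord mulnn.
Qed.

Lemma block_owners_sub R C u v :
  block_owners t phat I J R C u v \subset Z.
Proof. by apply/subsetP => _ /imsetP[xy _ ->]; exact: phat_cross. Qed.

Lemma scatter_subproblem_fits :
  all (fits jacobi25D_op Z 24) (scatter_subproblem b t c_gt0 phat (I, J)).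
Proof.
rewrite /= andbT; apply: (@fits_le _ _ _ 8) => //; apply: (@subproblem_tiles_fits _ 1).
move=> R C u v hR hC; apply: fits_size => //; rewrite /confined /= !andbT.
rewrite card_block_owners leqnn /= subUset sub1set !subsetI subsetUr block_owners_sub.
by rewrite !in_setI !in_setU !at_tile_cross at_tile_position !eqxx /= !andbT
  orbACA hR.
Qed.

Lemma solve_subproblem_fits :
  all (fits (@jacobi2D_op T s bh) Z 24) (solve_subproblem bh phat nsweeps (I, J)).
Proof.
rewrite all_flatten all_nseq /=; apply/orP; right.
exact/jacobi2D_sweep_fits/phat_cross/phat_inj.
Qed.

Lemma gather_and_update_fits :
  all (fits jacobi25D_op Z 24) (gather_and_update b t c_gt0 phat (I, J)).
Proof.
pose inC := (in_setI, in_setU, at_tile_cross, at_tile_position, eqxx, orbT).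
have subZ (F : 'I_q -> T) (P : pred 'I_q) (Y : {set T}) : (forall k, F k \in Y) ->
    [set F k | k : 'I_q & P k] \subset Y.
  by move=> h; apply/subsetP => _ /imsetP[k _ ->].
have card_im (F : 'I_q -> T) (P : pred 'I_q) : (#|[set F k | k : 'I_q & P k]| <= q)%N.
  by rewrite (leq_trans (leq_imset_card _ _)) // (leq_trans (max_card _)) ?card_ord.
have over_K k (l : seq 'I_q) (F : 'I_q -> step T) : uniq l ->
    (forall K, fits jacobi25D_op (Z :&: tile_cross K) k (F K)) ->
    fits jacobi25D_op Z (2 * k) (flatten [seq F K | K <- l]).
  move=> ul hF; apply: (@fits_flatten _ _ _ _ tile_cross _ _ k 2) => // x.
  exact: leq_trans (sum_uniq_le _ ul) (sum_tile_cross x).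
have uKs : uniq (enum 'I_q) by exact: enum_uniq.
have uKs' : uniq [seq K <- enum 'I_q | (K != I) && (K != J)] by exact: filter_uniq.
have at_pos Y k f : (forall u v, confined jacobi25D_op (Y :&: position (u, v)) (f u v)
      && (size (f u v) <= k)%N) ->
    fits jacobi25D_op Y k (each_pos f).
  move=> h; rewrite -[k]mul1n; apply: (fits_each_pos (Y := position)) => [u v|].
    by have /andP[h1 h2] := h u v; exact: fits_size.
  exact: sum_position.
(* Two products on the whole slab and one addition per position: 2 + 1. *)
have upd (Y : {set T}) R C : (forall u v r, at_tile R C u v r \in Y) ->
    fits jacobi25D_op Y 3 (tile_update mu b c_gt0 R C).
  move=> hY; apply: (@fits_cat _ _ _ 2 1).
    apply: fits_size => //.
    by rewrite /confined /= card_slab_layers !eqxx slab_layers_sub.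
  apply: at_pos => u v; rewrite /confined /= sub1set in_setI hY.
  by rewrite at_tile_position !eqxx leqnn.
(* The two messages issued at (u, v) also reach the mirror position (v, u), so each processor is met
   from two positions: 2 * 2. *)
have swap (Y : {set T}) R C : (forall u v r, at_tile R C u v r \in Y) ->
    fits jacobi25D_op Y 4 (tile_transposes mu b c_gt0 R C).
  move=> hY; apply: (fits_each_pos (Y := fun uv => position uv :|: position (uv.2, uv.1))
      (k := 2) (d := 2)) => [u v|x].
    case: eqP => _; apply: fits_size => //.
    by rewrite /confined /= !subUset !sub1set !in_setI !hY !inC leqnn.
  apply: (@leq_trans (\sum_uv (x \in position uv) +
      \sum_(uv : 'I_mu * 'I_mu) (x \in position (uv.2, uv.1)))).
    rewrite -big_split; apply: leq_sum => uv _; rewrite inE; by do 2!case: (_ \in _).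
  apply: (leq_add (sum_position x)).
  (* Mirroring positions is an involution, so the mirrored sum is the original one reindexed. *)
  have sw : {on predT, bijective (fun uv : 'I_mu * 'I_mu => (uv.2, uv.1))}.
    by exists (fun uv => (uv.2, uv.1)) => -[].
  by apply: leq_trans (sum_position x); rewrite (reindex _ sw).
apply/and5P; split; last (apply/and5P; split=> //).
- apply: (@fits_le _ _ _ 16) => //; apply: (@subproblem_tiles_fits _ 2).
  move=> R C u v hR hC; apply: fits_size => //; rewrite /confined /= !andbT.
  rewrite card_block_owners leqnn /= subUset sub1set !subsetI subsetUr block_owners_sub.
  by rewrite !inC /=; case/orP: hR => ->; rewrite ?orbT.
- apply: (@fits_le _ _ _ 2) => //; apply: at_pos => u v.
  by rewrite /confined /= !subUset !sub1set !inC leqnn.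
(* Two exchanges per [K] for A and one for Q, each made of two sends; tile crosses overlap at most
   twice. *)
- apply: (@fits_le _ _ _ 12) => //; apply: (@fits_cat _ _ _ (2 * 4) (2 * 2)).
    apply: over_K => // K; apply: at_pos => u v.
    by rewrite /confined /= !subUset !sub1set !inC leqnn.
  apply: over_K => // K; apply: at_pos => u v.
  by rewrite /confined /= !subUset !sub1set !inC leqnn.
- apply: (@fits_le _ _ _ (2 * 4)) => //.
  apply: (@fits_flatten _ _ _ _ (fun=> setT) _ _ 4 2) => [X XIJ|x]; last first.
    by rewrite !big_cons big_nil !in_setT.
  rewrite setIT; apply: at_pos => u v.
  have XZ K : (at_tile X K u v (Ordinal c_gt0) \in Z :&: position (u, v)) &&
              (at_tile K X u v (Ordinal c_gt0) \in Z :&: position (u, v)).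
    have /orP[] : (X == I) || (X == J) by move: XIJ; rewrite !inE.
      by move/eqP->; rewrite !inC.
    by move/eqP->; rewrite !inC.
  have row K := proj1 (andP (XZ K)); have col K := proj2 (andP (XZ K)).
  by rewrite /confined /= !subUset !sub1set !row !subZ // !card_im leqnn.
- apply: (@fits_le _ _ _ (2 * 8)) => //; apply: over_K => // K; apply: (@fits_cat _ _ _ 4 4);
    by apply: swap => u v r; rewrite !inC.
- apply: (@fits_le _ _ _ (2 * 6)) => //; apply: over_K => // K.
  by apply: (@fits_cat _ _ _ 3 3); apply: upd => u v r; rewrite !inC.
- apply: (@fits_le _ _ _ (2 * 6)) => //; apply: over_K => // K.
  by apply: (@fits_cat _ _ _ 3 3); apply: upd => u v r; rewrite !inC.
- apply: (@fits_le _ _ _ (2 * 6)) => //; apply: over_K => // K.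
  by apply: (@fits_cat _ _ _ 3 3); apply: upd => u v r; rewrite !inC.
Qed.

End Pair.

End Jacobi25D.

(** * Costs *)

Section Logarithm.
Variable R : realType.
Implicit Types x y : R.

Lemma log2_le x y : 0 < x -> x <= y -> log2 x <= log2 y.
Proof.
move=> x0 xy; rewrite /log2 ler_pM2r ?invr_gt0 ?ln_gt0 ?ltr1n //.
by rewrite ler_ln // posrE // (lt_le_trans x0).
Qed.

Lemma log2_ge0 x : 1 <= x -> 0 <= log2 x.
Proof. by move=> x1; rewrite divr_ge0 ?ln_ge0 // ler1n. Qed.

Lemma log2M x y : 0 < x -> 0 < y -> log2 (x * y) = log2 x + log2 y.
Proof. by move=> x0 y0; rewrite /log2 lnM ?posrE // mulrDl. Qed.

Lemma log2X x n : 0 < x -> log2 (x ^+ n) = n%:R * log2 x.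
Proof. by move=> x0; rewrite /log2 lnXn // mulrA mulr_natl. Qed.

Lemma log2_2 : log2 (2 : R) = 1.
Proof. by rewrite /log2 divff // gt_eqF // ln_gt0 // ltr1n. Qed.

(** In the theorem [s^2 / 2] is [eta mu sqrt(cP)], the argument of the first logarithm. The lower
    bound 1 lets constant message counts be absorbed. *)
Lemma log2_half_sqr_ge1 (s : nat) : (2 <= s)%N -> 1 <= log2 (s%:R ^+ 2 / 2 : R).
Proof.
rewrite -(ler_nat R) => s2; rewrite -[leLHS]log2_2; apply: log2_le => //.
by rewrite ler_pdivlMr // -expr2 ler_pXn2r // nnegrE.
Qed.

(** With y = s^2 >= 4, one has (y/2)^3 = 2 (y/4)^2 y >= 2 y >= 1 + y. The square would not suffice
    at s = 2, where 1 + y = 5 exceeds (y/2)^2 = 4. *)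
Lemma log2_le_half_sqr (s k : nat) : (2 <= s)%N -> (0 < k <= 1 + s ^ 2)%N ->
  log2 k%:R <= 3 * log2 (s%:R ^+ 2 / 2 : R).
Proof.
rewrite -(ler_nat R) -[(0 < k)%N](ltr_nat R) => s2 /andP[k0].
rewrite -(ler_nat R) natrD natrX => ks; set y : R := s%:R ^+ 2 in ks *.
have y4 : 4 <= y by rewrite /y; nra.
clearbody y.
rewrite -log2X; last by lra.
apply: log2_le => //; apply: (le_trans ks).
have y1 : 1 <= y / 4 by lra.
have y2 : 1 <= y / 4 * (y / 4) by apply: mulr_ege1.
have : 1 * y <= (y / 4) * (y / 4) * y by apply: ler_wpM2r => //; lra.
rewrite [X in _ -> _ <= X](_ : _ = 2 * (y / 4 * (y / 4) * y)); last by field.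
lra.
Qed.

End Logarithm.

(** * Cost of a single operation *)

Lemma card_setU1_bounds (T : finType) (x : T) (D : {set T}) k : (#|D| <= k)%N ->
  (0 < #|x |: D| <= 1 + k)%N.
Proof.
by move=> Dk; rewrite cardsU1; apply/andP; split; [rewrite -cardsU1; apply/card_gt0P;
  exists x; rewrite setU11 | apply: leq_add Dk; case: (_ \in _)].
Qed.

(** The extreme cases are broadcasts (2 * 3 logarithms), the message of three blocks, and the
    diagonalization of size 2 [bh], whose cube gives the factor 8. *)
Lemma jacobi2D_op_cost (R : realType) (kappa : R) (T : finType)
    (charge : operation T -> cost R) s bh o :
  0 <= kappa -> cost_model kappa charge -> (2 <= s)%N -> jacobi2D_op s bh o ->
  [/\ msgs (charge o) <= (kappa + 6) * log2 (s%:R ^+ 2 / 2),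
      words (charge o) <= (3 * kappa + 2) * bh%:R ^+ 2
    & flops (charge o) <= (8 * kappa + 1) * bh%:R ^+ 3].
Proof.
move=> kappa_ge0 cm s2; have := cm o; have L1 := log2_half_sqr_ge1 R s2.
have le_L k := @log2_le_half_sqr R s k s2.
move: (log2 (s%:R ^+ 2 / 2)) L1 le_L => L L1 le_L.
have h0 : 0 <= (bh%:R : R) by [].
have h2 : 0 <= (bh%:R : R) ^+ 2 by rewrite exprn_ge0.
have h3 : 0 <= (bh%:R : R) ^+ 3 by rewrite exprn_ge0.
have kL : 0 <= kappa * (L - 1) by rewrite mulr_ge0 // subr_ge0.
have k2 := mulr_ge0 kappa_ge0 h2; have k3 := mulr_ge0 kappa_ge0 h3.
have le_exp (k m e : nat) : (k <= m)%N -> (k%:R : R) ^+ e <= m%:R ^+ e.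
  by move=> km; rewrite lerXn2r ?nnegrE // ler_nat.
have le_kappa (u y y' : R) : 0 <= u <= kappa * y -> y <= y' -> u <= kappa * y'.
  by move=> /andP[_ uy] yy; apply: le_trans uy _; rewrite ler_wpM2l.
case: o => //= [x y w|x D w|x k|x k|x k].
- case=> hS hW ->; rewrite -(ler_nat R) natrM natrX => wb.
  have {hS} := le_kappa _ _ _ hS (lexx _); have {hW} := le_kappa _ _ _ hW wb.
  by move=> *; split; lra.
- case=> -> -> -> /andP[/(card_setU1_bounds x)/andP[D0 Ds]].
  rewrite -(ler_nat R) natrX => wb.
  have sl : (1 + s <= 1 + s ^ 2)%N by rewrite leq_add2l -mulnn leq_pmull //; lia.
  have : log2 #|x |: D|%:R <= 3 * L.
    by apply: le_L; rewrite D0 (leq_trans Ds).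
  by move: (log2 #|x |: D|%:R) => l *; split; lra.
- case=> -> -> hF /(le_exp _ _ 3) kb; have {hF} := le_kappa _ _ _ hF kb.
  by move=> *; split; lra.
- case=> -> -> -> kb; have k2b := le_exp _ _ 2 kb.
  have b23 : bh%:R ^+ 2 <= bh%:R ^+ 3 :> R.
    by rewrite -!natrX ler_nat; case: (bh) => // m; rewrite leq_pexp2l.
  by split; lra.
- case=> -> -> hF /(le_exp _ _ 3) kb; have {hF} := le_kappa _ _ _ hF kb.
  by rewrite natrM exprMn => *; split; lra.
Qed.

(** Serves to check the replication condition of the 2.5D product on a mu x mu x c grid: c^3 <= mu^2
    c follows from c <= mu. *)
Lemma le_powR_inv (R : realType) (x y : R) n :
  (0 < n)%N -> 0 <= x -> x ^+ n <= y -> x <= y `^ n%:R^-1.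
Proof.
move=> n0 x0 xy; have y0 : 0 <= y by apply: le_trans xy; rewrite exprn_ge0.
rewrite -(@ler_pXn2r _ n) // ?nnegrE ?powR_ge0 // -[leRHS]powR_mulrn ?powR_ge0 //.
by rewrite -powRrM mulVf ?powRr1 // pnatr_eq0 -lt0n.
Qed.

(** The 2.5D products dominate words and flops: since c <= mu, the size b^2 of a fine tile is at
    most both (mu/c) b^2 = B^2/(c mu) and (mu/c) b^3 = B^3/(mu^2 c). Their latency mu/c is at most
    [s]. *)
Lemma jacobi25D_op_cost (R : realType) (kappa : R) (q mu c s b : nat)
    (charge : operation (proc q mu c) -> cost R) o :
  0 <= kappa -> cost_model kappa charge ->
  (0 < q)%N -> (0 < b)%N -> (0 < c)%N -> (c <= mu)%N -> (2 * mu <= s)%N ->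
  jacobi25D_op s b o ->
  [/\ msgs (charge o) <=
        4 * (kappa + 1) * (s%:R * log2 (s%:R ^+ 2 / 2) + log2 q%:R),
      words (charge o) <= (kappa + 2) * ((mu * b)%:R ^+ 2 / (c * mu)%:R)
    & flops (charge o) <= (kappa + 1) * ((mu * b)%:R ^+ 3 / (mu ^ 2 * c)%:R)].
Proof.
move=> kappa_ge0 cm q0 b0 c0 cmu mus; have := cm o.
have s2 : (2 <= s)%N by lia.
have mu0 : (0 < mu)%N by lia.
have mu_sc : (mu <= s * c)%N.
  by rewrite (leq_trans _ (leq_pmulr _ c0)) // (leq_trans _ mus) // leq_pmull.
have c_s2 : (0 < c <= 1 + s ^ 2)%N.
  rewrite c0 (leq_trans cmu) // (leq_trans (leq_pmull mu (isT : 0 < 2)%N)) //.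
  by rewrite (leq_trans mus) // (leq_trans _ (leq_addl _ _)) // -mulnn leq_pmull //; lia.
have L1 := log2_half_sqr_ge1 R s2; set L := log2 _ in L1 *.
have s1 : 2 <= s%:R :> R by rewrite (ler_nat R 2).
have Ls : L <= s%:R * L by rewrite ler_peMl //; lra.
have ss : (s%:R : R) <= s%:R * L by rewrite ler_peMr.
have lq : 0 <= log2 (q%:R : R) by rewrite log2_ge0 // ler1n.
set U := s%:R * L in Ls ss *.
have kU : 0 <= kappa * (U - 1) by rewrite mulr_ge0 //; lra.
have klq : 0 <= kappa * log2 q%:R by rewrite mulr_ge0.
set W := _ / (c * mu)%:R; set F := _ / (mu ^ 2 * c)%:R.
have natr_gt0 k : (0 < k)%N -> 0 < (k%:R : R) by rewrite ltr0n.
have W0 : b%:R ^+ 2 <= W.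
  rewrite /W ler_pdivlMr ?natr_gt0 ?muln_gt0 ?c0 //.
  by rewrite -!natrX -natrM ler_nat expnMn mulnC leq_mul2r -mulnn leq_mul2r cmu !orbT.
have F0 : b%:R ^+ 2 <= F.
  rewrite /F ler_pdivlMr ?natr_gt0 ?muln_gt0 ?expn_gt0 ?mu0 //.
  rewrite -!natrX -natrM ler_nat expnMn (expnS mu) (expnS b).
  have := leq_mul cmu b0; have : (0 < b ^ 2 * mu ^ 2)%N by rewrite muln_gt0 !expn_gt0 b0 mu0.
  nia.
have b20 : 0 <= (b%:R : R) ^+ 2 by rewrite exprn_ge0.
have kW : 0 <= kappa * W by rewrite mulr_ge0 //; lra.
have kF : 0 <= kappa * F by rewrite mulr_ge0 //; lra.
have kWb : 0 <= kappa * (W - b%:R ^+ 2) by rewrite mulr_ge0 //; lra.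
have le_kappa (u y y' : R) : 0 <= u <= kappa * y -> y <= y' -> u <= kappa * y'.
  by move=> /andP[_ uy] yy; apply: le_trans uy _; rewrite ler_wpM2l.
have owners (x : proc q mu c) (D : {set proc q mu c}) w :
    (#|D| <= s ^ 2)%N && (w <= b ^ 2)%N ->
    log2 #|x |: D|%:R <= 3 * L /\ (w%:R : R) <= b%:R ^+ 2.
  move=> /andP[/(card_setU1_bounds x) Ds]; rewrite -natrX ler_nat; split=> //.
  exact: log2_le_half_sqr.
case: o => //= [x y w|x D w|x D w|x D w|x k|G N c'].
- case=> hS hW ->; rewrite -(ler_nat R) natrX => wb.
  have {hS} := le_kappa _ _ _ hS (lexx _); have {hW} := le_kappa _ _ _ hW wb.
  by move=> *; split; lra.
- by case=> -> -> -> /(owners x)[] *; split; lra.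
- by case=> -> -> -> /(owners x)[] *; split; lra.
- case=> -> -> -> /andP[/(card_setU1_bounds x)/andP[D0 Dq]].
  rewrite -(ler_nat R) natrX => wb.
  (* A broadcast has at most 1 + q <= 2 q participants. *)
  have : log2 #|x |: D|%:R <= 1 + log2 (q%:R : R).
    rewrite -[X in X + _]log2_2 -log2M ?natr_gt0 //; apply: log2_le; first exact: natr_gt0.
    by rewrite -natrM ler_nat (leq_trans Dq) // mul2n -addnn leq_add2r.
  by move=> *; split; lra.
- case=> -> -> -> kb.
  have : (k%:R : R) ^+ 2 <= b%:R ^+ 2 by rewrite lerXn2r ?nnegrE // ler_nat.
  by move=> *; split; lra.
- move=> h /and3P[/eqP Gc /eqP eN /eqP ec]; move: h; rewrite {}Gc {}eN {}ec.
  have cR : 0 < (c%:R : R) by exact: natr_gt0.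
  have mR : 0 < (mu%:R : R) by exact: natr_gt0.
  case=> //.
    apply: le_powR_inv => //; rewrite -!natrX ler_nat !expnS expn0 muln1 mulnA.
    by rewrite leq_mul2r leq_mul ?orbT.
  have -> : (mu * mu * c)%:R / c%:R ^+ 3 = (mu%:R / c%:R) ^+ 2 :> R.
    by rewrite !natrM; field; rewrite gt_eqF.
  have -> : c%:R * (mu * mu * c)%:R = ((c * mu)%:R) ^+ 2 :> R by rewrite !natrM; ring.
  have -> : (mu * mu * c = mu ^ 2 * c)%N by rewrite mulnn.
  rewrite !sqrtr_sqr !ger0_norm ?divr_ge0 // => hS hW hF.
  have : mu%:R / c%:R + log2 c%:R <= 4 * U.
    have : mu%:R / c%:R <= s%:R :> R.
      by rewrite ler_pdivrMr // -natrM ler_nat.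
    have : log2 c%:R <= 3 * L by apply: log2_le_half_sqr.
    lra.
  move=> /(le_kappa _ _ _ hS) {}hS; have {}hW := le_kappa _ _ _ hW (lexx _).
  have {}hF := le_kappa _ _ _ hF (lexx _).
  by rewrite -/W in hW; rewrite -/F in hF; split; lra.
Qed.

(* The constant is written 100 * 300 because numerals are unary. *)
Lemma jacobi25D_critical_path_le (R : realType) (q mu c s b bh t smax : nat) (c_gt0 : (0 < c)%N)
    (phat : 'I_q -> 'I_q -> 'I_s -> 'I_s -> proc q mu c)
    (nsweeps : 'I_q -> 'I_q -> nat) (f : operation (proc q mu c) -> R) (x y k Y V : R) :
  placement phat -> (forall I J, (nsweeps I J <= smax)%N) ->
  0 <= x -> 0 <= y ->
  (forall o, jacobi2D_op s bh o -> f o <= x) ->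
  (forall o, jacobi25D_op s b o -> f o <= y) ->
  0 <= k -> 0 <= Y -> 0 <= V ->
  q%:R * s%:R * x <= 64 * k * Y -> q%:R * y <= 8 * k * (Y + V) ->
  along_critical_path f (jacobi25D_sweep b bh t c_gt0 phat nsweeps) <=
    (100 * 300) * ((smax%:R + 1) * k) * (Y + V).
Proof.
move=> placed hsm x0 y0 fx fy k0 Y0 V0 xY yV.
(* Every step has degree at most 48 = 2 * 24. Per group there are at most 8 s [smax] solver steps
   and 1 + 8 others, so 384 = 8 * 48 and 432 = 9 * 48. *)
apply: (@le_trans _ _ (q%:R * (384 * (smax%:R * (s%:R * x)) + 432 * y))); last first.
  have -> : q%:R * (384 * (smax%:R * (s%:R * x)) + 432 * y) =
      384 * (smax%:R * (q%:R * s%:R * x)) + 432 * (q%:R * y) by ring.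
  (* Both 384 * 64 = 24576 and 24576 + 432 * 8 = 28032 stay below 30000. *)
  have := ler_wpM2l (ler0n R smax) xY.
  have := mulr_ge0 k0 Y0; have := mulr_ge0 k0 V0.
  have := mulr_ge0 (ler0n R smax) (mulr_ge0 k0 Y0).
  have := mulr_ge0 (ler0n R smax) (mulr_ge0 k0 V0).
  lra.
apply: critical_path_le; first by rewrite mulr_ge0 ?addr_ge0 ?mulr_ge0.
rewrite -[X in X%:R * _](size_iota 0) -(size_map (antidiag q)).
apply: path_le_flatten => g /mapP[K _ ->].
have -> : 384 * (smax%:R * (s%:R * x)) + 432 * y =
    1%:R * ((2 * 24)%:R * y) +
      ((smax * (s * 8))%:R * ((2 * 24)%:R * x) + 8%:R * ((2 * 24)%:R * y)).
  by rewrite !natrM; ring.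
have cover (z : proc q mu c) := antidiag_cover K (sum_tile_cross z).
apply: path_le_cat; last apply: path_le_cat.
- apply: (path_le_fits (p := jacobi25D_op s b) (Z := setT) _ fy) => //.
    apply: (par_fits (d := 2) _ cover) => -[I J] /antidiag_lt IJ; rewrite setTI.
    exact: scatter_subproblem_fits.
  by apply: size_par.
- apply: (path_le_fits (p := @jacobi2D_op _ s bh) (Z := setT) _ fx) => //.
    apply: (par_fits (d := 2) _ cover) => -[I J] /antidiag_lt IJ; rewrite setTI.
    exact: solve_subproblem_fits.
  apply: size_par => -[I J] _; rewrite size_flatten /shape map_nseq sumn_nseq mulnC.
  exact/leq_mul/size_jacobi2D_sweep.
- apply: (path_le_fits (p := jacobi25D_op s b) (Z := setT) _ fy) => //.
    apply: (par_fits (d := 2) _ cover) => -[I J] /antidiag_lt IJ; rewrite setTI.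
    exact: gather_and_update_fits.
  by apply: size_par => -[].
Qed.

(** * The quantity X and the final estimates *)

(** Used with x = q s, where X = x / sqrt 2. Comparing fourth powers, y <= 4 y <= 16 y, avoids the
    square root of 2. *)
Lemma powR_root_bounds (R : realType) (x y : R) :
  0 <= x -> 0 <= y -> y = x ^+ 4 / 4 -> y `^ 4^-1 <= x <= 2 * y `^ 4^-1.
Proof.
move=> x0 y0 exy; set z := y `^ _.
have z0 : 0 <= z by exact: powR_ge0.
have z4 : z ^+ 4 = y.
  by rewrite -powR_mulrn // -powRrM mulVf ?pnatr_eq0 // powRr1.
have x4 : 0 <= x ^+ 4 by rewrite exprn_ge0.
apply/andP; split.
  by rewrite -(@ler_pXn2r _ 4) // ?nnegrE // z4 exy; lra.
by rewrite -(@ler_pXn2r _ 4) // ?nnegrE ?mulr_ge0 // exprMn z4 exy; lra.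
Qed.

Theorem theorem3 (R : realType) (kappa : R) (smax : nat) (hkappa : 0 <= kappa) :
  exists C : R, 0 < C /\
  forall (n P c mu : nat) (eta : R)
    (* the derived integers: q = sqrt(P/c)/mu coarse tiles per side, fine tiles
       of size b = n/sqrt(P/c), an s x s grid of 2 eta mu sqrt(cP) processors
       for each subproblem, with blocks of size bh = 2B/s, and b = t bh *)
    (q b s bh t : nat)
    (n_gt0 : (0 < n)%N)
    (c_gt0 : (0 < c)%N) (c_le : c%:R <= P%:R `^ 3^-1 :> R)
    (mu_ge : (c <= mu)%N) (mu_le : mu%:R <= Num.sqrt (P%:R / c%:R) :> R)
    (eta_ge : 2 * mu%:R / Num.sqrt (c%:R * P%:R) <= eta) (eta_le : eta <= 1)
    (hq : Num.sqrt (P%:R / c%:R) = (q * mu)%:R :> R)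
    (hs : s%:R ^+ 2 = 2 * eta * mu%:R * Num.sqrt (c%:R * P%:R))
    (hn : n = (\sum_(I < q) mu * b)%N)
    (hN : (mu * b + mu * b = \sum_(i < s) bh)%N)
    (ht : s = (2 * mu * t)%N)
    (A Q A' Q' : 'M[R]_n) (nsweeps : 'I_q -> 'I_q -> nat)
    (phat : 'I_q -> 'I_q -> 'I_s -> 'I_s -> proc q mu c)
    (charge : operation (proc q mu c) -> cost R),
  A^T = A ->
  Q^T *m Q = 1%:M ->
  jacobi25D_run hn hN nsweeps A Q A' Q' ->
  (forall I J : 'I_q, (nsweeps I J <= smax)%N) ->
  placement phat ->
  cost_model kappa charge ->
  let sweep := jacobi25D_sweep b bh t c_gt0 phat nsweeps in
  let S := along_critical_path (fun o => msgs (charge o)) sweep in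
  let W := along_critical_path (fun o => words (charge o)) sweep in
  let F := along_critical_path (fun o => flops (charge o)) sweep in
  let X : R := (eta ^+ 2 * P%:R ^+ 3 / (mu%:R ^+ 2 * c%:R)) `^ 4^-1 in
  let m : R := Num.sqrt (P%:R / c%:R) / mu%:R in
  [/\ S <= C * (X * log2 (eta * mu%:R * Num.sqrt (c%:R * P%:R)) + m * log2 m),
      W <= C * (n%:R ^+ 2 / X + n%:R ^+ 2 / Num.sqrt (c%:R * P%:R))
    & F <= C * (n%:R ^+ 3 / X ^+ 2 + n%:R ^+ 3 / P%:R)].
Proof.
exists ((100 * 300) * ((smax%:R + 1) * (kappa + 1))).
split; first by rewrite !mulr_gt0 ?ltr_wpDl ?ltr01.
move=> n P c mu eta q b s bh t n_gt0 c_gt0 _ mu_ge _ eta_ge _ hq hs hn hN ht.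
move=> _ _ _ _ nsweeps phat charge _ _ _ hsm placed cm /=.
set X := _ `^ _.
have mu_gt0 : (0 < mu)%N by exact: leq_trans mu_ge.
have en : n = (q * (mu * b))%N by rewrite hn sum_nat_const card_ord.
have [q_gt0 b_gt0] : (0 < q)%N /\ (0 < b)%N.
  by move: n_gt0; rewrite en !muln_gt0 => /and3P[].
have eB : (2 * (mu * b) = s * bh)%N by rewrite mul2n -addnn hN sum_nat_const card_ord.
have natr_gt0 k : (0 < k)%N -> 0 < (k%:R : R) by rewrite ltr0n.
have cR := natr_gt0 _ c_gt0; have mR := natr_gt0 _ mu_gt0; have qR := natr_gt0 _ q_gt0.
have bR := natr_gt0 _ b_gt0.
have cN0 : c%:R != 0 :> R by rewrite gt_eqF.
have mN0 : mu%:R != 0 :> R by rewrite gt_eqF.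
have qN0 : q%:R != 0 :> R by rewrite gt_eqF.
(* From here on every square root of the statement becomes rational: P = c (q mu)^2 and sqrt(cP) = c
   q mu. *)
have eP : P%:R = c%:R * (q%:R * mu%:R) ^+ 2 :> R.
  by rewrite -natrM -hq sqr_sqrtr ?divr_ge0 //; field.
have ecP : Num.sqrt (c%:R * P%:R) = c%:R * (q%:R * mu%:R) :> R.
  have -> : c%:R * P%:R = (c%:R * (q%:R * mu%:R)) ^+ 2 :> R by rewrite eP; ring.
  by rewrite sqrtr_sqr ger0_norm // !mulr_ge0.
have D0 : 0 < c%:R * (q%:R * mu%:R) :> R by rewrite !mulr_gt0.
move: hs eta_ge; rewrite ecP => hs; rewrite ler_pdivrMr // => eta_ge.
(* The lower bound on [eta] says that s^2 = 2 eta mu sqrt(cP) is at least (2 mu)^2. *)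
have s_mu : (2 * mu <= s)%N.
  rewrite -(ler_nat R) -(@ler_pXn2r _ 2) ?nnegrE // hs natrM.
  have := ler_wpM2l (ltW mR) eta_ge; lra.
have s2 : (2 <= s)%N := leq_trans (leq_pmulr 2 mu_gt0) s_mu.
have s_gt0 : (0 < s)%N := ltnW s2.
have sR := natr_gt0 _ s_gt0; have sN0 : s%:R != 0 :> R by rewrite gt_eqF.
have -> : eta * mu%:R * (c%:R * (q%:R * mu%:R)) = s%:R ^+ 2 / 2.
  by rewrite hs; field.
have -> : Num.sqrt (P%:R / c%:R) / mu%:R = q%:R :> R by rewrite hq natrM mulfK.
(* Eliminating [eta] turns the fourth power of X into (q s)^4 / 4. *)
have eeta : eta = s%:R ^+ 2 / (2 * mu%:R * (c%:R * (q%:R * mu%:R))).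
  by rewrite hs; field; rewrite mN0 cN0 qN0.
have /andP[X_le X_ge] : X <= q%:R * s%:R <= 2 * X.
  apply: powR_root_bounds.
  - by rewrite mulr_ge0.
  - by rewrite eeta ?(divr_ge0, mulr_ge0, exprn_ge0).
  - by rewrite eeta eP; field; rewrite mN0 cN0 qN0.
have qs_gt0 : 0 < q%:R * s%:R :> R by rewrite mulr_gt0.
have X_gt0 : 0 < X by lra.
have L1 := log2_half_sqr_ge1 R s2.
have lq : 0 <= log2 (q%:R : R) by rewrite log2_ge0 // ler1n.
have cost2 o := @jacobi2D_op_cost R kappa _ charge s bh o hkappa cm s2.
have cost25 o := @jacobi25D_op_cost R kappa q mu c s b charge o hkappa cm
  q_gt0 b_gt0 c_gt0 mu_ge s_mu.
have eBR : bh%:R = 2 * (mu%:R * b%:R) / s%:R :> R.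
  by rewrite -!natrM eB natrM mulrAC mulfV // mul1r.
have enR : n%:R = q%:R * (mu%:R * b%:R) :> R by rewrite en !natrM.
split.
(* Here k = kappa + 1, Y = X log2(s^2/2) and V = q log2 q. *)
- apply: (jacobi25D_critical_path_le (x := (kappa + 6) * log2 (s%:R ^+ 2 / 2))
    (y := 4 * (kappa + 1) * (s%:R * log2 (s%:R ^+ 2 / 2) + log2 q%:R)) t c_gt0 placed hsm)
    => [| |o /cost2[] //|o /cost25[] //| | | | |];
    move: (log2 (s%:R ^+ 2 / 2)) (log2 q%:R) L1 lq => L l L1 l0.
  + by rewrite mulr_ge0 ?addr_ge0 //; lra.
  + by rewrite !mulr_ge0 ?addr_ge0 ?mulr_ge0 //; lra.
  + lra.
  + by rewrite mulr_ge0 ?ltW //; lra.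
  + by rewrite mulr_ge0.
  + have XL : q%:R * s%:R * L <= 2 * (X * L) by rewrite mulrA ler_wpM2r //; lra.
    have XL0 : 0 <= X * L by rewrite mulr_ge0 ?ltW //; lra.
    have := ler_wpM2l hkappa XL; have := mulr_ge0 hkappa XL0; lra.
  + have XL : q%:R * s%:R * L <= 2 * (X * L) by rewrite mulrA ler_wpM2r //; lra.
    have XL0 : 0 <= X * L by rewrite mulr_ge0 ?ltW //; lra.
    have ql0 : 0 <= q%:R * l by rewrite mulr_ge0.
    have := ler_wpM2l hkappa XL; have := mulr_ge0 hkappa XL0.
    have := mulr_ge0 hkappa ql0; lra.
- have n2 : 0 <= n%:R ^+ 2 :> R by rewrite exprn_ge0.
  have YX : 0 <= n%:R ^+ 2 / X by rewrite divr_ge0 // ltW.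
  have V0 : 0 <= n%:R ^+ 2 / (c%:R * (q%:R * mu%:R)) :> R by rewrite divr_ge0 // ltW.
  (* With bh = 2n/(qs), the q s solver steps of a sweep move q s bh^2 = 4 n^2/(qs) words up to a
     constant. *)
  have eU : q%:R * s%:R * bh%:R ^+ 2 = 4 * (n%:R ^+ 2 / (q%:R * s%:R)) :> R.
    by rewrite eBR enR; field; rewrite sN0 qN0.
  have U_le : n%:R ^+ 2 / (q%:R * s%:R) <= n%:R ^+ 2 / X.
    by rewrite ler_wpM2l // lef_pV2 ?posrE.
  have eV : q%:R * ((mu * b)%:R ^+ 2 / (c * mu)%:R) =
      n%:R ^+ 2 / (c%:R * (q%:R * mu%:R)) :> R.
    by rewrite enR !natrM; field; rewrite mN0 qN0 cN0.
  have W0 : 0 <= (mu * b)%:R ^+ 2 / (c * mu)%:R :> R by rewrite divr_ge0 ?exprn_ge0.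
  apply: (jacobi25D_critical_path_le (x := (3 * kappa + 2) * bh%:R ^+ 2)
    (y := (kappa + 2) * ((mu * b)%:R ^+ 2 / (c * mu)%:R)) t c_gt0 placed hsm)
    => [| |o /cost2[] //|o /cost25[] //| | | | |] //.
  + by rewrite mulr_ge0 ?exprn_ge0 //; lra.
  + by rewrite mulr_ge0 //; lra.
  + lra.
  + rewrite mulrCA eU; have := ler_wpM2l hkappa U_le; have := mulr_ge0 hkappa YX; lra.
  + rewrite mulrCA eV; have := mulr_ge0 hkappa YX; have := mulr_ge0 hkappa V0; lra.
- have n3 : 0 <= n%:R ^+ 3 :> R by rewrite exprn_ge0.
  have YX : 0 <= n%:R ^+ 3 / X ^+ 2 by rewrite divr_ge0 // exprn_ge0 // ltW.
  have V0 : 0 <= n%:R ^+ 3 / P%:R :> R by rewrite divr_ge0.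
  have eU : q%:R * s%:R * bh%:R ^+ 3 = 8 * (n%:R ^+ 3 / (q%:R * s%:R) ^+ 2) :> R.
    by rewrite eBR enR; field; rewrite sN0 qN0.
  have U_le : n%:R ^+ 3 / (q%:R * s%:R) ^+ 2 <= n%:R ^+ 3 / X ^+ 2.
    rewrite ler_wpM2l // lef_pV2 ?posrE ?exprn_gt0 //.
    by rewrite ler_pXn2r // nnegrE ltW.
  have eV : q%:R * ((mu * b)%:R ^+ 3 / (mu ^ 2 * c)%:R) = n%:R ^+ 3 / P%:R :> R.
    by rewrite enR eP !natrM; field; rewrite mN0 qN0 cN0.
  have F0 : 0 <= (mu * b)%:R ^+ 3 / (mu ^ 2 * c)%:R :> R by rewrite divr_ge0 ?exprn_ge0.
  apply: (jacobi25D_critical_path_le (x := (8 * kappa + 1) * bh%:R ^+ 3)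
    (y := (kappa + 1) * ((mu * b)%:R ^+ 3 / (mu ^ 2 * c)%:R)) t c_gt0 placed hsm)
    => [| |o /cost2[] //|o /cost25[] //| | | | |] //.
  + by rewrite mulr_ge0 ?exprn_ge0 //; lra.
  + by rewrite mulr_ge0 //; lra.
  + lra.
  (* This case dictates the constant 64 of the path lemma: 8 (8 kappa + 1) <= 64 (kappa + 1). *)
  + rewrite mulrCA eU; have := ler_wpM2l hkappa U_le; have := mulr_ge0 hkappa YX; lra.
  + rewrite mulrCA eV; have := mulr_ge0 hkappa YX; have := mulr_ge0 hkappa V0; lra.
Qed.
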